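(* Consider the problem $$\min f(x) \quad \text{subject to} \quad y_0 \in \Phi(x), \quad x \in A. \tag{$\mathcal{P}$}$$ Let the set $A$ be compact. Suppose that: (1) $f$ is lower semicontinuous on $A$, and locally Lipschitz continuous near globally optimal solutions of $(\mathcal{P})$; (2) $\Phi$ is metrically subregular with respect to the set $A$ at $(x^*,y_0)$ for every globally optimal solution $x^*$ of $(\mathcal{P})$; (3) the mapping $x \mapsto d(y_0,\Phi(x))$ is continuous on $A$; (4) $\phi$ is lower semicontinuous, and there exist $\phi_0 > 0$ and $t_0 > 0$ such that $\phi(t) \ge \phi_0 t$ for all $t \in [0,t_0]$; (5) $\beta$ is strictly increasing, and there exist $\beta_0 > 0$ and $\overline{\mu} > 0$ such that $\beta(\mu) \ge \beta_0 \mu$ for all $\mu \in [0,\overline{\mu}]$. Then the penalty function $F_\lambda$ is globally exact.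
   Context: Setting. Let $X$ and $Y$ be metric spaces (both metrics denoted $d$), $A \subset X$ a nonempty set, $\Phi \colon X \rightrightarrows Y$ a set-valued mapping with closed images, $y_0 \in Y$, and $f \colon X \to \mathbb{R} \cup \{+\infty\}$. Write $\mathbb{R}_+ = [0,+\infty)$, $d(x_0,C) = \inf_{x \in C} d(x_0,x)$ for the distance from a point to a set (equal to $+\infty$ if $C = \emptyset$), and $\Phi^{-1}(y) = \{x \in X \mid y \in \Phi(x)\}$. The feasible set of $(\mathcal{P})$ is $\Omega = \Phi^{-1}(y_0) \cap A$, assumed nonempty, and $f$ is assumed bounded below on $\Omega$. A globally optimal solution of $(\mathcal{P})$ is a point $x^* \in \Omega$ with $f(x^* ) \le f(x)$ for all $x \in \Omega$. Let $\phi \colon \mathbb{R}_+ \cup \{+\infty\} \to \mathbb{R}_+ \cup \{+\infty\}$ be non-decreasing with $\phi(t) = 0$ iff $t = 0$, and let $\beta \colon \mathbb{R}_+ \to \mathbb{R}_+ \cup \{+\infty\}$ be non-decreasing with $\beta(\mu) = 0$ iff $\mu = 0$. Define, for $x \in X$ and $\mu \in \mathbb{R}_+$, $$g(x,\mu) = \begin{cases} f(x), & x \in \Omega,\ \mu = 0, \\ +\infty, & x \notin \Omega,\ \mu = 0, \\ f(x) + \frac{1}{\mu}\,\phi\big(d(y_0,\Phi(x))^2\big), & \mu > 0, \end{cases} \qquad F_\lambda(x,\mu) = g(x,\mu) + \lambda \beta(\mu), \quad \lambda \ge 0.$$ Global exactness: $F_\lambda$ is called (globally) exact if there exists $\lambda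 \ge 0$ such that $F_\lambda$ attains a global minimum on $A \times \mathbb{R}_+$, and every global minimizer $(x^*,\mu^* )$ of $F_\lambda$ on $A \times \mathbb{R}_+$ satisfies $\mu^* = 0$. Metric subregularity: $\Phi$ is metrically subregular with respect to $A$ at $(\overline{x},\overline{y})$, where $\overline{x} \in A$ and $\overline{y} \in \Phi(\overline{x})$, if there exist $a > 0$ and a neighbourhood $U$ of $\overline{x}$ such that $d(\overline{y},\Phi(x)) \ge a\, d(x, \Phi^{-1}(\overline{y}) \cap A)$ for all $x \in U \cap A$. ''Locally Lipschitz continuous near $x^*$'' means that $f$ is real-valued and Lipschitz continuous on some neighbourhood of $x^*$. Extended-real-valued functions are understood with the usual topology of $[0,+\infty]$. *)

(* Defs.v *)
(* World: MathComp-Analysis. *)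
From HB Require Import structures.
From mathcomp Require Import all_boot all_order all_algebra.
From mathcomp Require Import all_classical all_reals all_analysis.

Set Implicit Arguments.
Unset Strict Implicit.
Unset Printing Implicit Defensive.

Import Order.TTheory GRing.Theory Num.Theory.
Import numFieldNormedType.Exports.

Local Open Scope classical_set_scope.
Local Open Scope ring_scope.

(* The distance d(x, C) to a set is the library's [edist_inf C x], which is
   stated for pseudometric spaces; on a metric space it is the infimum of the
   distances, with value +oo when C is empty. *)
Lemma edist_mdist (R : realType) (X : metricType R) (x y : X) :
  edist (x, y) = (mdist x y)%:E.
Proof.
rewrite /edist /=; apply/eqP; rewrite eq_le; apply/andP; split; last first.
  apply: le_ereal_inf_tmp => _ [r [r0 +] <-].
  by rewrite ballEmdist /= => /ltW; rewrite lee_fin.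
apply/lee_addgt0Pr => e e0; apply: ereal_inf_lbound.
exists (mdist x y + e) => //; split.
  by rewrite ltr_wpDl // mdist_ge0.
by rewrite ballEmdist /= ltrDl.
Qed.

Lemma edist_infE (R : realType) (X : metricType R) (C : set X) (x : X) :
  edist_inf C x = ereal_inf [set (mdist x z)%:E | z in C].
Proof.
by rewrite /edist_inf; congr ereal_inf; apply: eq_imagel => z _; rewrite edist_mdist.
Qed.

Section penalty.
Context {R : realType} {X Y : metricType R}.
Implicit Types (A C : set X) (Phi : X -> set Y) (f : X -> \bar R).

Definition inverse_image Phi (y : Y) : set X := [set x | Phi x y].

Definition feasible_set A Phi (y0 : Y) : set X := inverse_image Phi y0 `&` A.

Definition globally_optimal A Phi (y0 : Y) f (xs : X) : Prop :=
  feasible_set A Phi y0 xs /\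
  forall x, feasible_set A Phi y0 x -> (f xs <= f x)%E.

Definition locally_lipschitz_near f (x : X) : Prop :=
  exists2 U : set X, nbhs x U &
    (forall y, U y -> f y \is a fin_num) /\
    exists L : R, forall y z, U y -> U z ->
      `|fine (f y) - fine (f z)| <= L * mdist y z.

Definition metrically_subregular A Phi (xb : X) (yb : Y) : Prop :=
  exists2 a : R, 0 < a &
  exists2 U : set X, nbhs xb U &
    forall x, U x -> A x ->
      (a%:E * edist_inf (inverse_image Phi yb `&` A) x
       <= edist_inf (Phi x) yb)%E.

(* [phi] is only used on [0, +oo] and [beta], [smoothing_term _ x] and
   [penalty_function _ x] only on [0, +oo[. *)
Definition smoothing_term A Phi (y0 : Y) f (phi : \bar R -> \bar R)
    (x : X) (mu : R) : \bar R :=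
  if mu == 0 then (if x \in feasible_set A Phi y0 then f x else +oo%E)
  else (f x + (mu^-1)%:E * phi (edist_inf (Phi x) y0 ^+ 2))%E.

Definition penalty_function A Phi (y0 : Y) f (phi : \bar R -> \bar R)
    (beta : R -> \bar R) (lambda : R) (x : X) (mu : R) : \bar R :=
  (smoothing_term A Phi y0 f phi x mu + lambda%:E * beta mu)%E.

Definition global_minimizer A (F : X -> R -> \bar R) (xs : X) (mus : R) : Prop :=
  [/\ A xs, 0 <= mus &
      forall x mu, A x -> 0 <= mu -> (F xs mus <= F x mu)%E].

Definition globally_exact A (F : R -> X -> R -> \bar R) : Prop :=
  exists2 lambda : R, 0 <= lambda &
    (exists xs mus, global_minimizer A (F lambda) xs mus) /\
    (forall xs mus, global_minimizer A (F lambda) xs mus -> mus = 0).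

End penalty.

(* Main.v *)
Require Import Defs.
From HB Require Import structures.
From mathcomp Require Import all_boot all_order all_algebra.
From mathcomp Require Import all_classical all_reals all_analysis.
From mathcomp Require Import ring lra.

Import Order.TTheory GRing.Theory Num.Theory.
Import numFieldNormedType.Exports.

Local Open Scope classical_set_scope.
Local Open Scope ring_scope.

Set Implicit Arguments.
Unset Strict Implicit.
Unset Printing Implicit Defensive.

(** Let [v] be the optimal value of the constrained problem, and abbreviate
    [h x = edist_inf (Phi x) y0]. It suffices to find one [lambda] for which the
    penalty function stays strictly above [v] at every [x] in [A] and every
    [mu > 0]: on the slice [mu = 0] it is [f] on the feasible set and [+oo]
    elsewhere, so its minimizers are then exactly the pairs [(xs, 0)] with [xs]
    globally optimal.

    Both the local hypotheses at optimal solutions and the behaviour of the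
    penalty far from them are condensed into one error bound, a quadratic growth
    condition holding with a single constant [c > 0] at all points of [A]:

        [f x <= v]  implies  [c * (v - f x)^2 <= phi (h x ^ 2)].

    Given this bound, put [s = v - f x]. The arithmetic-geometric inequality
    gives [c s^2 / mu + mu / (4 c) >= s], and [lambda * beta mu] dominates
    [mu / (4 c)] for small [mu], since [beta] grows at least linearly there;
    for large [mu] it dominates [s] itself, which is bounded as [f] is bounded
    below on [A] ([quadratic_linear_tradeoff], [penalty_exceeds_optimum]).

    Near a given point of [A] the growth condition holds for one of three
    reasons, and compactness of [A] makes the constant uniform
    ([compact_uniform_constant]):
    - if [f x0 > v], lower semicontinuity makes the condition void near [x0];
    - if [x0] is infeasible, [phi (h x ^ 2)] is bounded away from [0] near [x0],
      while [v - f x] is bounded ([quadratic_growth_infeasible]);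
    - otherwise [x0] is optimal, and Clarke's exact penalization argument shows
      that near [x0] the decrease [v - f x] is at most [L] times the distance
      to the feasible set ([optimal_decrease_le_dist]), hence, by subregularity,
      at most a multiple of [h x]; since [phi t >= phi0 * t] for small [t], the
      square of this decrease is controlled by [phi (h x ^ 2)]
      ([quadratic_growth_optimal]). *)

(** * Lower semicontinuous functions and compactness *)

Lemma lsc_subspace_near (R : realType) (T : topologicalType) (A : set T)
    (f : T -> \bar R) (x : T) (a : R) :
  lower_semicontinuous (f : subspace A -> \bar R) -> A x -> (a%:E < f x)%E ->
  \forall x' \near x, A x' -> (a%:E < f x')%E.
Proof.
move=> lscf Ax /lscf[V xV aV].
have : within A (nbhs x) V by rewrite nbhs_subspace_in.
rewrite /within /=; apply: filterS => x' AV /AV; exact: aV.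
Qed.

(** Weierstrass' theorem. If no point were a minimizer, each [x] of [K] would
    have a neighbourhood on which [f] stays above some value [f z] with [z] in
    [K]; by compactness, [f y < f x] would hold for all [x] in [K] as soon as
    [y] lies in a small enough sublevel set, in particular for [x = y]. *)
Lemma lsc_compact_argmin (R : realType) (T : topologicalType) (A K : set T)
    (f : T -> \bar R) :
  lower_semicontinuous (f : subspace A -> \bar R) -> (forall x, f x != -oo%E) ->
  K `<=` A -> compact K -> K !=set0 ->
  exists2 x, K x & forall y, K y -> (f x <= f y)%E.
Proof.
move=> lscf fNy KA /compact_near_coveringP cK [x0 Kx0].
apply: contrapT => nomin.
have below x : K x -> exists2 z, K z & (f z < f x)%E.
  move=> Kx; apply: contrapT => nz; apply: nomin; exists x => // y Ky.
  by rewrite leNgt; apply/negP => fyx; apply: nz; exists y.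
pose F := filter_from K (fun z => [set y | K y /\ (f y <= f z)%E]).
have FF : ProperFilter F.
  apply: filter_from_proper; last by move=> z Kz; exists z; split.
  apply: filter_from_filter; first by exists x0.
  move=> i j Ki Kj; have [ij|/ltW ji] := leP (f i) (f j).
    by exists i => // y [Ky yi]; split; split => //; exact: le_trans ij.
  by exists j => // y [Ky yj]; split; split => //; exact: le_trans ji.
have : \forall y \near F, K `<=` [set x | K x -> (f y < f x)%E].
  apply: (cK _ F (fun y x => K x -> (f y < f x)%E)) => x Kx.
  have [z Kz fzx] := below _ Kx.
  (* Lower semicontinuity only speaks of real thresholds, hence [a]; it
     exists because [f z] is neither infinity. *)
  have [a fza afx] : exists2 a, (f z <= a%:E)%E & (a%:E < f x)%E.
    move: fzx (fNy z); case: (f z) => [a| |] //; first by exists a.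
    by rewrite ltNge leey.
  have nx := lsc_subspace_near lscf (KA _ Kx) afx.
  near=> x' y => /= Kx'.
  have [Ky fyz] : [set y | K y /\ (f y <= f z)%E] y by near: y; exists z.
  apply: (le_lt_trans fyz); apply: (le_lt_trans fza).
  by move: (KA _ Kx'); near: x'.
move=> [z Kz /(_ z)] /(_ (conj Kz (lexx _)) z Kz Kz).
by rewrite ltxx.
Unshelve. all: by end_near. Qed.

(** As [P c] weakens when [c] decreases to [0], near each point of [K] it holds
    for all small enough [c]; compactness provides one threshold for all points. *)
Lemma compact_uniform_constant (R : realType) (T : topologicalType) (K : set T)
    (P : R -> T -> Prop) :
  compact K -> (forall (c c' : R) x, 0 < c -> c <= c' -> P c' x -> P c x) ->
  (forall x, K x -> exists2 c : R, 0 < c & \forall x' \near x, P c x') ->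
  exists2 c : R, 0 < c & forall x, K x -> P c x.
Proof.
move=> /compact_near_coveringP cK Pdec Ploc.
have : \forall c \near (0:R)^'+, K `<=` P c.
  apply: cK => x /Ploc[c0 c0_gt0 Pc0].
  near=> x' c; apply: (Pdec c c0) => /=; last by near: x'.
    by [].
  by near: c; exact: nbhs_right_ltW.
move=> KP; near (0 : R)^'+ => c.
by exists c => //; near: c.
Unshelve. all: by end_near. Qed.

(** * The feasible set *)

Lemma edist_inf_eq0 (R : realType) (X : metricType R) (C : set X) (x : X) :
  closed C -> edist_inf C x = 0%E -> C x.
Proof.
move=> cC dx0; apply: cC => B /nbhs_ballP[e /= e0 eB].
have : (edist_inf C x < e%:E)%E by rewrite dx0 lte_fin.
rewrite edist_infE => /ereal_inf_lt[_ [z Cz <-]]; rewrite lte_fin => xz.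
by exists z; split => //; apply: eB; rewrite ballEmdist.
Qed.

Lemma feasible_set_compact (R : realType) (X Y : metricType R) (A : set X)
    (Phi : X -> set Y) (y0 : Y) :
  (forall x, closed (Phi x)) -> compact A ->
  {within A, continuous (fun x => edist_inf (Phi x) y0)} ->
  compact (feasible_set A Phi y0).
Proof.
move=> cPhi cA ch.
have -> : feasible_set A Phi y0 =
    A `&` ((fun x => edist_inf (Phi x) y0) @^-1` [set 0%E]).
  apply/seteqP; split=> x [].
    by move=> Phix Ax; split => //=; exact: edist_inf0.
  by move=> Ax /edist_inf_eq0 Phix; split => //; exact: Phix.
have /closed_subspaceP[V cV VE] : closed
    ((fun x => edist_inf (Phi x) y0) @^-1` [set 0%E] : set (subspace A)).
  move/continuous_closedP : ch; apply.
  exact: accessible_closed_set1 (hausdorff_accessible (@ereal_hausdorff R)) _.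
by rewrite setIC -VE setIC; exact: compact_closedI.
Qed.

(** * Local quadratic growth *)

(** The error bound of the introduction at the point [x], with [v] the optimal
    value. The premise [A x] is part of the condition so that it can be
    asserted on full neighbourhoods in [X]. *)
Definition quadratic_growth {R : realType} {X Y : metricType R} (A : set X)
    (Phi : X -> set Y) (y0 : Y) (f : X -> \bar R) (phi : \bar R -> \bar R)
    (v c : R) (x : X) : Prop :=
  A x -> (f x <= v%:E)%E ->
  ((c * (v - fine (f x)) ^+ 2)%:E <= phi (edist_inf (Phi x) y0 ^+ 2))%E.

(** Clarke's exact penalization. If [x] is close to [xs], a feasible [z] close
    to [x] lies in the Lipschitz neighbourhood and satisfies [f xs <= f z]. A
    feasible [z] farther away is at least as far from [x] as [xs] is, so the
    Lipschitz estimate between [x] and [xs] already gives the bound. *)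
Lemma optimal_decrease_le_dist (R : realType) (X Y : metricType R) (A : set X)
    (Phi : X -> set Y) (y0 : Y) (f : X -> \bar R) (xs : X) :
  globally_optimal A Phi y0 f xs -> locally_lipschitz_near f xs ->
  exists2 L : R, 0 < L & \forall x \near xs, f x \is a fin_num /\
    forall z, feasible_set A Phi y0 z ->
      fine (f xs) - fine (f x) <= L * mdist x z.
Proof.
move=> [Oxs opt] [U /nbhs_ballP[r /= r0 rU] [Ufin [L0 Lip]]].
(* The given constant may be zero or negative; [L] is divided by later. *)
pose L := `|L0| + 1.
have L_gt0 : 0 < L by rewrite ltr_wpDl.
have LipL x z : U x -> U z -> `|fine (f x) - fine (f z)| <= L * mdist x z.
  move=> Ux Uz; apply: (le_trans (Lip _ _ Ux Uz)).
  by rewrite ler_wpM2r ?mdist_ge0 // (le_trans (ler_norm _)) // lerDl.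
exists L => //; have r20 : 0 < r / 2 by rewrite divr_gt0.
near=> x; have xsx : ball xs (r / 2) x by near: x; exact: nbhsx_ballx.
have Ux : U x by apply: rU; apply: le_ball xsx; lra.
have Uxs : U xs by apply: rU; exact: ballxx.
split=> [|z Oz]; first exact: Ufin.
(* With [x] within [r / 2] of [xs], [xz] places [z] within [r] of [xs]. *)
have [xz|xz] := ltP (mdist x z) (r / 2).
  have Uz : U z by apply: rU; apply: (@ball_split _ _ x) => //; rewrite ballEmdist.
  have := LipL x z Ux Uz; have := opt z Oz.
  rewrite -(fineK (Ufin _ Uz)) -(fineK (Ufin _ Uxs)) lee_fin /=.
  rewrite ler_norml => ? /andP[? ?]; lra.
have /ball_sym := xsx; rewrite ballEmdist /= => xxs.
have := LipL x xs Ux Uxs; rewrite ler_norml => /andP[+ _].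
have : L * mdist x xs <= L * mdist x z.
  by rewrite ler_pM2l // (le_trans (ltW xxs)).
lra.
Unshelve. all: by end_near. Qed.

(** Subregularity turns the bound by the distance to the feasible set into
    [a * (v - f x) / L <= h x]. On a small ball the left-hand side stays below
    [sqrt t0], so that the linear growth of [phi] applies to its square, and
    monotonicity of [phi] transfers the estimate to [h x ^ 2], which need
    neither be small nor finite. *)
Lemma quadratic_growth_optimal (R : realType) (X Y : metricType R) (A : set X)
    (Phi : X -> set Y) (y0 : Y) (f : X -> \bar R) (phi : \bar R -> \bar R)
    (phi0 t0 : R) (xs : X) :
  (forall s t : \bar R, (0 <= s)%E -> (s <= t)%E -> (phi s <= phi t)%E) ->
  0 < phi0 -> 0 < t0 ->
  (forall t : R, 0 <= t <= t0 -> ((phi0 * t)%:E <= phi t%:E)%E) ->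
  globally_optimal A Phi y0 f xs -> locally_lipschitz_near f xs ->
  metrically_subregular A Phi xs y0 ->
  exists2 c : R, 0 < c & \forall x \near xs,
    quadratic_growth A Phi y0 f phi (fine (f xs)) c x.
Proof.
move=> phi_nd phi0_gt0 t0_gt0 phi_ge opt Lip [a a_gt0 [U Uxs sub]].
have [L L_gt0 dec] := optimal_decrease_le_dist opt Lip.
have aL_gt0 : 0 < a / L by rewrite divr_gt0.
exists (phi0 * (a / L) ^+ 2); first by rewrite mulr_gt0 // exprn_gt0.
have e_gt0 : 0 < Num.sqrt t0 / a by rewrite divr_gt0 // sqrtr_gt0.
have [fxs _] := nbhs_singleton dec.
near=> x => Ax fx_le.
have Ux : U x by near: x.
have [fx declez] : f x \is a fin_num /\ forall z, feasible_set A Phi y0 z ->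
  fine (f xs) - fine (f x) <= L * mdist x z by near: x.
have : ball xs (Num.sqrt t0 / a) x by near: x; exact: nbhsx_ballx.
move=> /ball_sym; rewrite ballEmdist /= ltr_pdivlMr // => xxs.
have := declez _ opt.1; set s := _ - _ in declez * => sxs.
have s_ge0 : 0 <= s.
  by rewrite subr_ge0 -lee_fin fineK.
pose q := a * (s / L).
have q_ge0 : 0 <= q by rewrite mulr_ge0 ?divr_ge0 // ltW.
have qh : (q%:E <= edist_inf (Phi x) y0)%E.
  apply: le_trans (sub x Ux Ax); rewrite EFinM lee_pmul2l ?lte_fin //.
  rewrite edist_infE; apply: le_ereal_inf_tmp => _ [z Oz <-].
  by rewrite lee_fin ler_pdivrMr // mulrC declez.
have qt0 : q ^+ 2 <= t0.
  rewrite -(sqr_sqrtr (ltW t0_gt0)) ler_sqr ?nnegrE ?sqrtr_ge0 //.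
  rewrite (le_trans _ (ltW xxs)) // /q mulrC ler_pM2r // ler_pdivrMr //.
  by rewrite mulrC.
have -> : phi0 * (a / L) ^+ 2 * s ^+ 2 = phi0 * q ^+ 2.
  by rewrite /q; field; rewrite gt_eqF.
apply: (le_trans (phi_ge _ _)); first by rewrite sqr_ge0.
apply: phi_nd; first by rewrite lee_fin sqr_ge0.
by rewrite EFin_expe lee_sqr // (le_trans _ qh).
Unshelve. all: by end_near. Qed.

(** Near a point where [h] is positive, [phi (h x ^ 2)] is bounded below by some
    [k > 0], and [0 <= v - f x <= v - m]; the constant
    [k / ((v - m) ^ 2 + 1)] makes the left-hand side at most [k]. *)
Lemma quadratic_growth_infeasible (R : realType) (X Y : metricType R) (A : set X)
    (Phi : X -> set Y) (y0 : Y) (f : X -> \bar R) (phi : \bar R -> \bar R)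
    (m v : R) (x0 : X) :
  (forall x, A x -> (m%:E <= f x)%E) ->
  (forall t : \bar R, (0 <= t)%E -> (0 <= phi t)%E) ->
  (forall s t : \bar R, (0 <= s)%E -> (s <= t)%E -> (phi s <= phi t)%E) ->
  (forall t : \bar R, (0 <= t)%E -> (phi t = 0%E <-> t = 0%E)) ->
  {within A, continuous (fun x => edist_inf (Phi x) y0)} ->
  A x0 -> edist_inf (Phi x0) y0 != 0%E ->
  exists2 c : R, 0 < c & \forall x \near x0,
    quadratic_growth A Phi y0 f phi v c x.
Proof.
move=> fm phi_ge0 phi_nd phi_eq0 ch Ax0 hx0.
have [d d_gt0 dh] : exists2 d : R, 0 < d & (d%:E < edist_inf (Phi x0) y0)%E.
  have : (0 < edist_inf (Phi x0) y0)%E by rewrite lt_neqAle eq_sym hx0 edist_inf_ge0.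
  case: edist_inf => [r| |] //; last by exists 1 => //; rewrite ltry.
  by rewrite lte_fin => r0; exists (r / 2); rewrite ?lte_fin; lra.
have [k k_gt0 kphi] : exists2 k : R, 0 < k & (k%:E <= phi (d%:E ^+ 2))%E.
  have d2 : (0 <= d%:E ^+ 2)%E by rewrite -EFin_expe lee_fin sqr_ge0.
  have : (0 < phi (d%:E ^+ 2))%E.
    rewrite lt_neqAle phi_ge0 // andbT eq_sym; apply/eqP => /(phi_eq0 _ d2).
    by rewrite -EFin_expe => -[] /eqP; rewrite sqrf_eq0 gt_eqF.
  case: (phi _) => [r| |] //; first by exists r.
  by exists 1 => //; rewrite leey.
have D_gt0 : 0 < (v - m) ^+ 2 + 1 by rewrite ltr_wpDl ?sqr_ge0.
exists (k / ((v - m) ^+ 2 + 1)); first by rewrite divr_gt0.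
have hd : \forall x \near x0, A x -> (d%:E < edist_inf (Phi x) y0)%E.
  have /subspace_continuousP/(_ _ Ax0) hc := ch.
  exact: hc _ (open_ereal_gt' dh).
apply: filterS hd => x /[swap] Ax /(_ Ax) dhx fxv.
apply: (@le_trans _ _ k%:E).
  have := fm x Ax; move: fxv; case: (f x) => [r| |] //.
  rewrite !lee_fin /= => rv mr.
  rewrite mulrAC ler_pdivrMr // ler_pM2l // ler_wpDr // ler_sqr ?nnegrE; lra.
apply: (le_trans kphi); apply: phi_nd.
  by rewrite -EFin_expe lee_fin sqr_ge0.
by rewrite lee_sqr ?edist_inf_ge0 ?(ltW dhx) // lee_fin ltW.
Qed.

(** * The penalty function above the optimal value *)

(** For [mu <= m] the inequality follows from
    [c s^2 / mu - s + mu / (4 c) = (2 c s - mu)^2 / (4 c mu)], as the term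
    [(c b)^-1] of the coefficient contributes [mu / c]. For [mu > m] the term
    [(S + 1) / (b m)] alone contributes [S + 1 > s]. *)
Lemma quadratic_linear_tradeoff (R : realType) (c b m S s mu : R) :
  0 < c -> 0 < b -> 0 < m -> 0 <= s <= S -> 0 < mu ->
  s < c * s ^+ 2 / mu + ((c * b)^-1 + (S + 1) / (b * m)) * (b * Num.min mu m).
Proof.
move=> c0 b0 m0 /andP[s0 sS] mu0.
have S0 : 0 <= S by exact: le_trans sS.
have [mum|/ltW mmu] := leP mu m.
  have : 0 <= (c * s ^+ 2 / mu - s + mu / c / 4).
    have -> : c * s ^+ 2 / mu - s + mu / c / 4 = (2 * c * s - mu) ^+ 2 / (4 * c * mu).
      by field; rewrite !gt_eqF.
    by rewrite divr_ge0 ?sqr_ge0 // !mulr_ge0 // ltW.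
  have -> : ((c * b)^-1 + (S + 1) / (b * m)) * (b * mu) = mu / c + (S + 1) * mu / m.
    by field; rewrite !gt_eqF.
  have : 0 < mu / c by rewrite divr_gt0.
  have : 0 < (S + 1) * mu / m by rewrite divr_gt0 // mulr_gt0 // ltr_wpDl.
  lra.
have -> : ((c * b)^-1 + (S + 1) / (b * m)) * (b * m) = m / c + S + 1.
  by field; rewrite !gt_eqF.
have : 0 < m / c by rewrite divr_gt0.
have : 0 <= c * s ^+ 2 / mu by rewrite divr_ge0 ?mulr_ge0 ?sqr_ge0 // ltW.
lra.
Qed.

(** Points with [f x > v] are harmless because the other terms are
    nonnegative. At the others, [beta mu] is bounded below, by monotonicity, by
    [b0 * min mu mu0], and the growth condition reduces the claim to
    [quadratic_linear_tradeoff] with [s = v - f x]. *)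
Lemma penalty_exceeds_optimum (R : realType) (X Y : metricType R) (A : set X)
    (Phi : X -> set Y) (y0 : Y) (f : X -> \bar R) (phi : \bar R -> \bar R)
    (beta : R -> \bar R) (m v c b0 mu0 : R) :
  (forall x, f x != -oo%E) ->
  (forall t : \bar R, (0 <= t)%E -> (0 <= phi t)%E) ->
  (forall mu nu : R, 0 <= mu -> mu <= nu -> (beta mu <= beta nu)%E) ->
  (forall x, A x -> (m%:E <= f x)%E) ->
  0 < c ->
  (forall x, A x -> quadratic_growth A Phi y0 f phi v c x) ->
  0 < b0 -> 0 < mu0 ->
  (forall mu : R, 0 <= mu <= mu0 -> ((b0 * mu)%:E <= beta mu)%E) ->
  exists2 lambda : R, 0 <= lambda & forall x mu, A x -> 0 < mu ->
    (v%:E < penalty_function A Phi y0 f phi beta lambda x mu)%E.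
Proof.
move=> fNy phi_ge0 beta_nd fm c_gt0 growth b0_gt0 mu0_gt0 beta_ge.
(* [v - m] may be negative when no point of [A] satisfies [f x <= v]. *)
pose S := Num.max 0 (v - m).
have S_ge0 : 0 <= S by rewrite le_max lexx.
pose lambda := (c * b0)^-1 + (S + 1) / (b0 * mu0).
have lambda_gt0 : 0 < lambda.
  by rewrite addr_gt0 ?invr_gt0 ?divr_gt0 ?mulr_gt0 ?ltr_wpDl.
exists lambda => [|x mu Ax mu_gt0]; first exact: ltW.
rewrite /penalty_function /smoothing_term gt_eqF //.
set h := edist_inf _ _; pose w := Num.min mu mu0.
have w_gt0 : 0 < w by rewrite lt_min mu_gt0.
have beta_w : ((b0 * w)%:E <= beta mu)%E.
  apply: (@le_trans _ _ (beta w)).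
    by apply: beta_ge; rewrite (ltW w_gt0) /w ge_min lexx orbT.
  by apply: beta_nd; [exact: ltW | rewrite /w ge_min lexx].
have lbeta : ((lambda * (b0 * w))%:E <= lambda%:E * beta mu)%E.
  by rewrite EFinM lee_pmul2l // lte_fin.
have h2_ge0 : (0 <= h ^+ 2)%E by rewrite expe_ge0 // edist_inf_ge0.
apply: (@lt_le_trans _ _
    (f x + (mu^-1)%:E * phi (h ^+ 2) + (lambda * (b0 * w))%:E)%E); last first.
  exact: leeD2l.
have [fxv|vfx] := leP (f x) v%:E; last first.
  apply: (@lt_le_trans _ _ (f x)) => //.
  rewrite -addeA leeDl // adde_ge0 //.
    by rewrite mule_ge0 ?phi_ge0 // lee_fin invr_ge0 ltW.
  by rewrite lee_fin !mulr_ge0 ?ltW.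
apply: (@lt_le_trans _ _ (f x + (mu^-1)%:E * (c * (v - fine (f x)) ^+ 2)%:E
    + (lambda * (b0 * w))%:E)%E); last first.
  rewrite leeD2r // leeD2l // lee_pmul2l ?lte_fin ?invr_gt0 //.
  exact: growth.
move: (fNy x) (fm _ Ax) fxv; case: (f x) => [r| |] //= _.
rewrite !lee_fin => mr rv; rewrite -!EFinM -!EFinD lte_fin.
have sS : 0 <= v - r <= S.
  by rewrite subr_ge0 rv le_max lerD2l lerN2 mr orbT.
have := quadratic_linear_tradeoff c_gt0 b0_gt0 mu0_gt0 sS mu_gt0.
rewrite -/lambda -/w [_ / mu]mulrC; lra.
Qed.

(** * Global exactness *)

Unset Implicit Arguments.

Theorem theorem4 (R : realType) (X Y : metricType R)
  (A : set X) (Phi : X -> set Y) (y0 : Y) (f : X -> \bar R)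
  (phi : \bar R -> \bar R) (beta : R -> \bar R)
  (* standing assumptions *)
  (A_neq0 : A !=set0)
  (Phi_closed : forall x, closed (Phi x))
  (f_proper : forall x, f x != -oo%E)
  (feasible_neq0 : feasible_set A Phi y0 !=set0)
  (f_lower_bounded :
    exists m : R, forall x, feasible_set A Phi y0 x -> (m%:E <= f x)%E)
  (phi_ge0 : forall t : \bar R, (0 <= t)%E -> (0 <= phi t)%E)
  (phi_nondecreasing :
    forall s t : \bar R, (0 <= s)%E -> (s <= t)%E -> (phi s <= phi t)%E)
  (phi_eq0 : forall t : \bar R, (0 <= t)%E -> (phi t = 0%E <-> t = 0%E))
  (beta_ge0 : forall mu : R, 0 <= mu -> (0 <= beta mu)%E)
  (beta_nondecreasing :
    forall mu nu : R, 0 <= mu -> mu <= nu -> (beta mu <= beta nu)%E)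
  (beta_eq0 : forall mu : R, 0 <= mu -> (beta mu = 0%E <-> mu = 0))
  (* hypotheses of the theorem *)
  (A_compact : compact A)
  (f_lsc : lower_semicontinuous (f : subspace A -> \bar R))
  (f_lipschitz : forall xs, globally_optimal A Phi y0 f xs ->
    locally_lipschitz_near f xs)
  (Phi_subregular : forall xs, globally_optimal A Phi y0 f xs ->
    metrically_subregular A Phi xs y0)
  (dist_continuous :
    {within A, continuous (fun x => edist_inf (Phi x) y0)})
  (phi_lsc : lower_semicontinuous
    (phi : subspace [set t : \bar R | (0 <= t)%E] -> \bar R))
  (phi_growth : exists phi0 t0 : R, [/\ 0 < phi0, 0 < t0 &
    forall t : R, 0 <= t <= t0 -> ((phi0 * t)%:E <= phi t%:E)%E])
  (beta_increasing :
    forall mu nu : R, 0 <= mu -> mu < nu -> (beta mu < beta nu)%E)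
  (beta_growth : exists beta0 mu0 : R, [/\ 0 < beta0, 0 < mu0 &
    forall mu : R, 0 <= mu <= mu0 -> ((beta0 * mu)%:E <= beta mu)%E]) :
  globally_exact A (penalty_function A Phi y0 f phi beta).
Proof.
have [m fm] : exists m : R, forall x, A x -> (m%:E <= f x)%E.
  have [x Ax xmin] := lsc_compact_argmin f_lsc f_proper
    (@subset_refl _ A) A_compact A_neq0.
  exists (fine (f x)) => y /xmin; move: (f_proper x).
  by case: (f x) => [r| |] //= _; exact: le_trans (leey _).
have cO := feasible_set_compact Phi_closed A_compact dist_continuous.
have [xs Oxs xs_min] := lsc_compact_argmin f_lsc f_proper
  (@subIsetr _ _ _) cO feasible_neq0.
have opt : globally_optimal A Phi y0 f xs by [].
(* If [f] were [+oo] on the feasible set, every feasible point would be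
   optimal, contradicting the Lipschitz hypothesis. *)
have fxs : f xs \is a fin_num.
  by have [U Uxs [Ufin _]] := f_lipschitz _ opt; exact: Ufin (nbhs_singleton Uxs).
pose v := fine (f xs).
have vE : f xs = v%:E by rewrite fineK.
have [phi0 [t0 [phi0_gt0 t0_gt0 phi_ge]]] := phi_growth.
have [c c_gt0 growth] : exists2 c : R, 0 < c &
    forall x, A x -> quadratic_growth A Phi y0 f phi v c x.
  apply: compact_uniform_constant A_compact _ _.
    move=> c c' x c_gt0 cc' + Ax fxv => /(_ Ax fxv); apply: le_trans.
    by rewrite lee_fin ler_wpM2r // sqr_ge0.
  move=> x0 Ax0.
  have [hx0|hx0] := eqVneq (edist_inf (Phi x0) y0) 0%E; last first.
    exact: (quadratic_growth_infeasible (m := m)).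
  have Ox0 : feasible_set A Phi y0 x0 by split => //; exact: edist_inf_eq0 hx0.
  have [fx0|vfx0] := leP (f x0) v%:E.
    have opt0 : globally_optimal A Phi y0 f x0.
      by split=> // x Ox; rewrite (le_trans fx0) // -vE xs_min.
    have fx0E : f x0 = v%:E by apply/eqP; rewrite eq_le fx0 -vE xs_min.
    have := quadratic_growth_optimal phi_nondecreasing
      phi0_gt0 t0_gt0 phi_ge opt0 (f_lipschitz _ opt0) (Phi_subregular _ opt0).
    by rewrite fx0E.
  exists 1 => //; have := lsc_subspace_near f_lsc Ax0 vfx0.
  by apply: filterS => x vfx Ax; rewrite leNgt vfx.
have [beta0 [mu0 [beta0_gt0 mu0_gt0 beta_ge]]] := beta_growth.
have [lambda lambda_ge0 Fgt] := penalty_exceeds_optimum f_proper phi_ge0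
  beta_nondecreasing fm c_gt0 growth beta0_gt0 mu0_gt0 beta_ge.
have beta0E : beta 0 = 0%E by exact/beta_eq0.
have Fxs : penalty_function A Phi y0 f phi beta lambda xs 0 = v%:E.
  by rewrite /penalty_function /smoothing_term eqxx mem_set // beta0E mule0 adde0.
exists lambda => //; split.
  exists xs, 0; split=> [|//|x mu Ax]; first exact: Oxs.2.
  rewrite le_eqVlt => /predU1P[<-|mu_gt0]; last by rewrite Fxs ltW // Fgt.
  rewrite Fxs /penalty_function /smoothing_term eqxx beta0E mule0 adde0.
  by case: ifPn => [/set_mem Ox|_]; rewrite ?leey // -vE xs_min.
move=> x mu [Ax + Fmin]; rewrite le_eqVlt => /predU1P[//|mu_gt0].
have := Fmin xs 0 Oxs.2 (lexx _).
by rewrite Fxs leNgt Fgt.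
Qed.
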